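(* Let $C_n$ be the cycle of length $n$ ($n\ge 3$) and let $C'_n$ be the graph obtained from $C_n$ by removing an edge $uv$ (keeping all vertices). Then $meg(C'_n)=2$.
   Context: Graphs are finite, undirected and simple. In a connected graph $H$, an edge $e$ is monitored by a pair of vertices $x,y$ if $e$ lies on all shortest paths between $x$ and $y$. A set $M\subseteq V(H)$ is a monitoring edge-geodetic set (MEG-set) of $H$ if every edge of $H$ is monitored by some pair of vertices of $M$; $meg(H)$ is the minimum size of a MEG-set of $H$. *)

(* Defs.v *)
From mathcomp Require Import all_boot boolp zify.
Set Implicit Arguments.
Unset Strict Implicit.
Unset Printing Implicit Defensive.

Record sgraph (T : finType) := SGraph {
  adj :> rel T;
  adj_sym : symmetric adj;
  adj_irr : irreflexive adj }.

Definition connected_graph (T : finType) (G : sgraph T) : Prop :=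
  forall x y : T, connect G x y.

Definition is_edge (T : finType) (G : sgraph T) (e : {set T}) : Prop :=
  exists x y : T, G x y /\ e = [set x; y].

(* As in [path], a path x = x_0, x_1, ..., x_k = y is given by its origin x and
   the sequence p = [:: x_1; ...; x_k]; its length is [size p]. *)
Definition is_path (T : finType) (G : sgraph T) (x y : T) (p : seq T) : Prop :=
  [/\ path G x p, last x p = y & uniq (x :: p)].

Definition is_shortest_path (T : finType) (G : sgraph T) (x y : T) (p : seq T)
    : Prop :=
  is_path G x y p /\ (forall q, is_path G x y q -> size p <= size q).

Definition path_edges (T : finType) (x : T) (p : seq T) : seq {set T} :=
  [seq [set ab.1; ab.2] | ab <- zip (x :: p) p].

(* Intended for connected graphs only: if no path joins x and y, the condition
   is vacuous. A cycle minus an edge is connected: see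
   [del_edge_cycle_connected]. *)
Definition monitored (T : finType) (G : sgraph T) (e : {set T}) (x y : T)
    : Prop :=
  forall p, is_shortest_path G x y p -> e \in path_edges x p.

Definition MEG_set (T : finType) (G : sgraph T) (M : {set T}) : Prop :=
  forall e, is_edge G e ->
    exists x y : T, [/\ x \in M, y \in M & monitored G e x y].

(* The default value [set: T] is itself a MEG-set, by [MEG_setT] below. *)
Definition meg (T : finType) (G : sgraph T) : nat :=
  #|[arg min_(M < [set: T] | `[< MEG_set G M >]) #|M|]|.

Lemma MEG_setT (T : finType) (G : sgraph T) : MEG_set G [set: T].
Proof.
move=> e [x [y [xy ->]]]; exists x, y; rewrite !inE; split=> // p [] [] _.
have xNy : x != y by apply: contraTneq xy => ->; rewrite adj_irr.
have pxy : is_path G x y [:: y] by split; rewrite /= ?xy ?inE ?xNy.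
case: p => [/= xE|a [|b p]] /=; first by rewrite xE eqxx in xNy.
  by move=> -> _ _; rewrite /path_edges /= inE.
by move=> _ _ /(_ _ pxy).
Qed.

Definition cycle_adj (n : nat) : rel 'I_n :=
  [rel i j | (j == ordS i) || (i == ordS j)].

Lemma cycle_adj_sym (n : nat) : symmetric (@cycle_adj n).
Proof. by move=> i j; rewrite /cycle_adj /= orbC. Qed.

Lemma cycle_adj_irr (n : nat) : 2 < n -> irreflexive (@cycle_adj n).
Proof.
move=> n_ge3 i; rewrite /cycle_adj /= orbb; apply/negP => /eqP/(congr1 val) /=.
have := ltn_ord i; case: (ltngtP i.+1 n) => // [lt _|iE _].
  by rewrite modn_small // => /n_Sn.
by rewrite iE modnn; lia.
Qed.

Definition cycle_graph (n : nat) (n_ge3 : 2 < n) : sgraph 'I_n :=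
  SGraph (@cycle_adj_sym n) (cycle_adj_irr n_ge3).

Definition del_edge_adj (T : finType) (G : sgraph T) (u v : T) : rel T :=
  [rel x y | G x y && ([set x; y] != [set u; v])].

Lemma del_edge_sym (T : finType) (G : sgraph T) (u v : T) :
  symmetric (del_edge_adj G u v).
Proof. by move=> x y; rewrite /del_edge_adj /= adj_sym setUC. Qed.

Lemma del_edge_irr (T : finType) (G : sgraph T) (u v : T) :
  irreflexive (del_edge_adj G u v).
Proof. by move=> x; rewrite /del_edge_adj /= adj_irr. Qed.

Definition del_edge (T : finType) (G : sgraph T) (u v : T) : sgraph T :=
  SGraph (del_edge_sym G u v) (del_edge_irr G u v).

Lemma val_iter_ordS (n : nat) (i : 'I_n) (k : nat) :
  val (iter k (@ordS n) i) = (i + k) %% n.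
Proof.
elim: k => [|k IHk] /=; first by rewrite addn0 modn_small.
by rewrite [nat_of_ord _]IHk -addn1 modnDml -addnA addn1.
Qed.

Lemma del_edge_cycle_connected (n : nat) (n_ge3 : 2 < n) (u v : 'I_n) :
  cycle_graph n_ge3 u v -> connected_graph (del_edge (cycle_graph n_ge3) u v).
Proof.
wlog -> : u v / v = ordS u.
  move=> W uv; case/orP: (uv) => /eqP E; first exact: W.
  have vu : cycle_graph n_ge3 v u by rewrite adj_sym.
  move=> x y; apply: etrans (W v u E vu x y); apply: eq_connect => a b.
  by rewrite /= /del_edge_adj /= [[set u; v]]setUC.
move=> _; set G := del_edge _ _ _; set w := ordS u.
have reach k : k < n -> connect G w (iter k (@ordS n) w).
  elim: k => [|k IHk] ltkn; first exact: connect0.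
  apply: connect_trans (IHk (ltnW ltkn)) (connect1 _).
  apply/andP; split; first by apply/orP; left.
  apply/negP => /eqP/setP E.
  have inj a b : a <= n -> b < a -> a - b < n ->
      iter a (@ordS n) u = iter b (@ordS n) u -> False.
    move=> len ltb ltab /(congr1 val); rewrite !val_iter_ordS => /eqP.
    rewrite eqn_mod_dvd; last by lia.
    by rewrite (_ : u + a - (u + b) = a - b) ?gtnNdvd //; lia.
  have iE m : iter m (@ordS n) w = iter m.+1 (@ordS n) u by rewrite iterSr.
  have := E u; rewrite !inE eqxx /= -[ordS _]/(iter k.+1 _ w) !iE.
  case/orP=> /eqP ue; first by apply: (inj k.+1 0); rewrite -?ue //; lia.
  have k2n : k.+2 = n.
    case: (ltngtP k.+2 n) => // lt; last by lia.
    by case: (inj k.+2 0); rewrite -?ue //; lia.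
  have := E w; rewrite !inE eqxx orbT !iE.
  rewrite -[w]/(iter 1 (@ordS n) u).
  case/orP=> /eqP we; first by apply: (inj k.+1 1); rewrite -?we //; lia.
  by apply: (inj k.+2 1); rewrite -?we //; lia.
have all x : connect G w x.
  have -> : x = iter ((x + (n - w)) %% n) (@ordS n) w.
    apply: val_inj; rewrite val_iter_ordS modnDmr.
    rewrite (_ : w + (x + (n - w)) = x + n); last by have := ltn_ord w; lia.
    by rewrite modnDr modn_small.
  by apply: reach; rewrite ltn_mod; lia.
move=> x y; apply: connect_trans (all y).
by rewrite (sym_connect_sym (@adj_sym _ G)).
Qed.

(* Main.v *)
(* Numbering the vertices of the cycle from v round to u, adjacent vertices of
   the cycle minus uv have consecutive numbers. A path from v to u goes from the
   least number to the greatest in unit steps, so by a discrete intermediate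
   value argument it crosses every edge: {v, u} is a MEG-set. One vertex is not
   enough, as the shortest path from a vertex to itself has no edge. *)
Require Import Defs.
From mathcomp Require Import all_boot boolp zify.

Set Implicit Arguments.
Unset Strict Implicit.
Unset Printing Implicit Defensive.

Section Graph.
Variables (T : finType) (G : sgraph T).

Lemma meg_eq (M : {set T}) :
  MEG_set G M -> (forall M' : {set T}, MEG_set G M' -> #|M| <= #|M'|) ->
  meg G = #|M|.
Proof.
move=> GM minM; rewrite /meg.
case: arg_minnP => [|N /asboolP GN minN]; first exact/asboolP/MEG_setT.
by apply/eqP; rewrite eqn_leq minM // minN //; apply/asboolP.
Qed.

Lemma MEG_set_card_gt1 (M : {set T}) (x y : T) :
  G x y -> MEG_set G M -> 1 < #|M|.
Proof.
move=> xy /(_ [set x; y]) [|a [b [aM bM mon]]]; first by exists x, y.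
apply/card_gt1P; exists a, b; split=> //; apply/eqP => ab.
by have: [set x; y] \in path_edges a [::] by apply: mon; split.
Qed.

Section Numbering.
Variable f : T -> nat.
Hypothesis f_inj : injective f.
Hypothesis f_adj : forall x y, G x y -> f y = (f x).+1 \/ f x = (f y).+1.

(** The first step of the path that leaves the vertices numbered at most [f x] ascends by exactly
    one, so it goes from number [f x] to number [f y]; injectivity identifies its ends with [x] and
    [y]. *)
Lemma path_crosses_edge (x y a : T) (p : seq T) :
  f y = (f x).+1 -> path G a p -> f a <= f x -> f y <= f (last a p) ->
  [set x; y] \in path_edges a p.
Proof.
move=> fxy; elim: p a => [|b p IHp] a /=; first by lia.
case/andP=> ab bp lax lyl; rewrite /path_edges /= inE.
have [lbx|ltxb] := leqP (f b) (f x); first by apply/orP; right; apply: IHp.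
have [-> ->] : x = a /\ y = b; last by rewrite eqxx.
by split; apply: f_inj; case: (f_adj ab); lia.
Qed.

(** The edge [xy] serves the lower bound: it forces [s] and [t] to differ and every MEG-set to have
    two vertices. *)
Lemma meg_numbering (s t x y : T) :
  (forall z, f s <= f z <= f t) -> G x y -> meg G = 2.
Proof.
move=> st xy; have sNt : s != t.
  apply/eqP => E; have := st x; have := st y; rewrite E.
  by case: (f_adj xy); lia.
have card_st : #|[set s; t]| = 2 by rewrite cards2 sNt.
rewrite -card_st; apply: meg_eq => [|M GM]; last first.
  by rewrite card_st (MEG_set_card_gt1 xy GM).
move=> e [a [b [ab ->]]]; exists s, t; rewrite !inE !eqxx orbT; split=> //.
move=> p [[sp pt _] _]; have [/andP[sa at_] /andP[sb bt]] := (st a, st b).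
case: (f_adj ab) => E; last rewrite setUC.
  by apply: path_crosses_edge; rewrite ?pt.
by apply: path_crosses_edge; rewrite ?pt.
Qed.

End Numbering.
End Graph.

Lemma val_ordS (n : nat) (i : 'I_n) :
  val (ordS i) = if i.+1 == n then 0 else i.+1.
Proof.
have := ltn_ord i; case: eqP => /= [->|]; first by rewrite modnn.
by move=> ? ?; rewrite modn_small //; lia.
Qed.

(** [G] is any graph with this adjacency, so that the case [u = ordS v] follows by exchanging [u]
    and [v]. *)
Lemma meg_cycle_del_ordS (n : nat) (u v : 'I_n) (G : sgraph 'I_n) :
  2 < n -> v = ordS u ->
  (forall x y, G x y = cycle_adj x y && ([set x; y] != [set u; v])) ->
  meg G = 2.
Proof.
move=> n_gt2 v_ordS GE.
(* This is [x - v] modulo [n], the number of [ordS] steps from [v] to [x]; thus [f v = 0] and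
   [f u = n - 1]. *)
pose f (x : 'I_n) := if v <= x then x - v else x + n - v.
have vE : v = (if u.+1 == n then 0 else u.+1) :> nat.
  by rewrite v_ordS; apply: val_ordS.
have f_inj : injective f.
  move=> x y fxy; apply: val_inj => /=; move: fxy; rewrite /f.
  by have := (ltn_ord x, ltn_ord y, ltn_ord v) => -[[]];
    do ! case: ifP => ?; lia.
have f_ordS x : x != u -> f (ordS x) = (f x).+1.
  move=> xNu; have := val_ordS x; rewrite /f /= => ->.
  have {}xNu : x <> u :> nat by move/val_inj/eqP; apply/negP.
  have := (ltn_ord x, ltn_ord u) => -[]; move: vE.
  by case: (x.+1 =P n) => ?; do ! case: ifP => ?; lia.
(* The numbering wraps around only from [u] to [ordS u = v], and that edge is deleted. *)
have f_adj x y : G x y -> f y = (f x).+1 \/ f x = (f y).+1.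
  rewrite GE => /andP[/orP[]/eqP-> ne]; [left|right]; apply: f_ordS;
    by apply: contra_neq ne => ->; rewrite v_ordS // setUC.
apply: (meg_numbering f_inj f_adj (s := v) (t := u) (x := v) (y := ordS v)).
  move=> z; have := (ltn_ord z, ltn_ord u) => -[]; move: vE.
  by rewrite /f /=; do ! case: ifP => ?; lia.
have vNu : v != u.
  by apply/eqP => /(congr1 val) /=; have := ltn_ord u; case: ifP vE; lia.
(* The edge from [v] to [ordS v] survives: [ordS v = u] would give [f u = 1], but [n - 1 > 1]. *)
rewrite GE /cycle_adj /= eqxx /=; apply/eqP => /setP/(_ u).
rewrite !inE eqxx eq_sym (negPf vNu) /= => /eqP/(congr1 f).
rewrite (f_ordS _ vNu) /f; have := ltn_ord u; move: vE.
by do ! case: ifP => ?; lia.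
Qed.

Theorem corollary3p3 (n : nat) (n_ge3 : 2 < n) (u v : 'I_n)
    (uv_edge : cycle_graph n_ge3 u v) :
  meg (del_edge (cycle_graph n_ge3) u v) = 2.
Proof.
case/orP: uv_edge => /eqP E; first exact: meg_cycle_del_ordS E _.
by apply: meg_cycle_del_ordS E _ => // x y; rewrite [[set v; u]]setUC.
Qed.
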